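(* Let $(X,d_X)$ be a metric space and $f:X\to\overline{\mathbb{R}}=[-\infty,\infty]$. For each $n\in\mathbb{N}$ let $X^n\subset X$, let $T_n:\mathbb{R}^n\to X^n$ be a surjective mapping, let $f_n:\mathbb{R}^n\to\overline{\mathbb{R}}$ be given by $f_n(x_n)=f(T_n(x_n))$, and let $f_n^\nu:\mathbb{R}^n\to\overline{\mathbb{R}}$, $\nu\in\mathbb{N}$, be functions. Suppose that the following hold for some $\bar n\in\mathbb{N}$: (a) $f+\iota_{X^n}$ epi-converges to $f$ as $n\to\infty$. (b) For all $n\ge\bar n$, $f_n^\nu$ epi-converges to $f_n$ as $\nu\to\infty$. (c) $\inf f>-\infty$ and, for all $n\ge\bar n$, $\inf f_n<\infty$. Then, for any $\epsilon\in(0,\infty)$, there exists $n_\epsilon\ge\bar n$ such that whenever $n\ge n_\epsilon$, $\delta^\nu\in[0,\infty)$ with $\delta^\nu\to\delta\in[0,\infty)$ as $\nu\to\infty$, and a sequence $\{\bar x_n^\nu\in\delta^\nu\text{-}\operatorname{argmin} f_n^\nu,\ \nu\in\mathbb{N}\}$ has a cluster point $\bar x_n\in\mathbb{R}^n$, one has $$f\big(T_n(\bar x_n)\big)\le \inf f+\epsilon+\delta .$$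
   Context: For a set $C$, the indicator function is $\iota_C(c)=0$ if $c\in C$ and $\iota_C(c)=\infty$ otherwise. Extended arithmetic uses $\infty-\infty=\infty$. For a function $g$ from a metric space $Y$ to $\overline{\mathbb{R}}$: $\inf g=\inf\{g(y)\mid y\in Y\}$, $\operatorname{dom} g=\{y\in Y\mid g(y)<\infty\}$, and for $\delta\in[0,\infty)$, $\delta\text{-}\operatorname{argmin} g=\{y\in\operatorname{dom} g\mid g(y)\le\inf g+\delta\}$. Epi-convergence: for $g^\nu,g:Y\to\overline{\mathbb{R}}$, $g^\nu$ epi-converges to $g$ as $\nu\to\infty$ when at every $y\in Y$: (a) for all $y^\nu\to y$, $\liminf_\nu g^\nu(y^\nu)\ge g(y)$; and (b) there exists $y^\nu\to y$ such that $\limsup_\nu g^\nu(y^\nu)\le g(y)$. $\mathbb{R}^n$ carries its Euclidean metric. *)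

(* Defs.v *)
From HB Require Import structures.
From mathcomp Require Import all_boot all_order all_algebra.
From mathcomp Require Import all_classical all_reals all_analysis.

Set Implicit Arguments.
Unset Strict Implicit.
Unset Printing Implicit Defensive.

Import Order.TTheory GRing.Theory Num.Theory.
Import numFieldNormedType.Exports.

Local Open Scope classical_set_scope.
Local Open Scope ring_scope.

(* The library's metric on 'rV[R]_n is the one of the sup norm; [euclidean R n]
   is an alias of 'rV[R]_n that does not inherit it and whose [mdist] is the
   Euclidean distance instead. *)
Definition euclidean (R : realType) (n : nat) : Type := 'rV[R]_n.

Section euclidean_metric.
Context {R : realType} {n : nat}.
Implicit Types x y z : 'rV[R]_n.

Definition euclid_dist x y : R := Num.sqrt (\sum_(i < n) (x ord0 i - y ord0 i) ^+ 2).

Let sqsum_ge0 (a : 'I_n -> R) : 0 <= \sum_i a i ^+ 2.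
Proof. by apply: sumr_ge0 => i _; exact: sqr_ge0. Qed.

Let euclid_distxx x : euclid_dist x x = 0.
Proof.
by rewrite /euclid_dist big1 ?sqrtr0// => i _; rewrite subrr expr0n.
Qed.

Let euclid_dist_positivity x y : euclid_dist x y = 0 -> x = y.
Proof.
move=> /eqP; rewrite /euclid_dist sqrtr_eq0 => le0.
have /eqP : \sum_(i < n) (x ord0 i - y ord0 i) ^+ 2 = 0.
  by apply/eqP; rewrite eq_le le0 sqsum_ge0.
rewrite psumr_eq0; last by move=> i _; exact: sqr_ge0.
move=> /allP xy; apply/rowP => i.
have := xy i (mem_index_enum i).
by rewrite /= sqrf_eq0 subr_eq0 => /eqP.
Qed.

Let euclid_dist_sym x y : euclid_dist x y = euclid_dist y x.
Proof.
by congr Num.sqrt; apply: eq_bigr => i _; rewrite -sqrrN opprB.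
Qed.

Let cauchy_schwarz (a b : 'I_n -> R) :
  \sum_i a i * b i <=
  Num.sqrt (\sum_i a i ^+ 2) * Num.sqrt (\sum_i b i ^+ 2).
Proof.
rewrite -sqrtrM ?sqsum_ge0//; apply: le_trans (ler_norm _) _.
rewrite -sqrtr_sqr ler_wsqrtr//.
set A := \sum_i a i ^+ 2; set B := \sum_i b i ^+ 2; set C := \sum_i a i * b i.
have quad (s t : R) : 0 <= s ^+ 2 * A - s * t * C *+ 2 + t ^+ 2 * B.
  rewrite (_ : _ + _ = \sum_i (s * a i - t * b i) ^+ 2) ?sqsum_ge0//.
  rewrite /A /B /C !mulr_sumr -sumrMnl -sumrB -big_split/=.
  apply: eq_bigr => i _; rewrite sqrrB !exprMn.
  by congr (_ - _ *+ 2 + _); rewrite mulrACA.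
have A0 : 0 <= A by exact: sqsum_ge0.
have B0 : 0 <= B by exact: sqsum_ge0.
have [B00|Bneq0] := eqVneq B 0.
  have b0 i : b i = 0.
    move: B00 => /eqP; rewrite psumr_eq0; last by move=> j _; exact: sqr_ge0.
    by move=> /allP/(_ i (mem_index_enum i))/=; rewrite sqrf_eq0 => /eqP.
  have -> : C = 0 by rewrite /C big1// => i _; rewrite b0 mulr0.
  by rewrite expr0n/= mulr_ge0.
have Bgt0 : 0 < B by rewrite lt_def Bneq0.
have := quad B C.
rewrite (_ : _ + _ = B * (A * B - C ^+ 2)); last first.
  rewrite mulrBr [C ^+ 2 * B]mulrC -(mulrA B C C) -expr2 mulr2n opprD.
  by rewrite addrA subrK expr2 -mulrA (mulrC B A).
by rewrite pmulr_rge0// subr_ge0.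
Qed.

Let euclid_dist_triangle y x z : euclid_dist x z <= euclid_dist x y + euclid_dist y z.
Proof.
rewrite -(@ler_pXn2r _ 2)//; [|exact: sqrtr_ge0|by rewrite nnegrE addr_ge0// sqrtr_ge0].
rewrite sqrrD /euclid_dist !sqr_sqrtr ?sqsum_ge0//.
pose a i := x ord0 i - y ord0 i; pose b i := y ord0 i - z ord0 i.
have -> : \sum_(i < n) (x ord0 i - z ord0 i) ^+ 2 =
    \sum_i a i ^+ 2 + (\sum_i a i * b i) *+ 2 + \sum_i b i ^+ 2.
  rewrite -sumrMnl -!big_split/=; apply: eq_bigr => i _.
  by rewrite -sqrrD /a /b addrA subrK.
rewrite lerD2r lerD2l lerMn2r/=.
exact: cauchy_schwarz.
Qed.

HB.instance Definition _ := Choice.copy (euclidean R n) 'rV[R]_n.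
HB.instance Definition _ := @isMetric.Build R (euclidean R n) euclid_dist
  euclid_distxx euclid_dist_positivity euclid_dist_sym euclid_dist_triangle.

End euclidean_metric.

Section extended_real_valued_functions.
Context {R : realType} {Y : Type}.
Implicit Types (C : set Y) (g : Y -> \bar R) (delta : R).

Definition indicator C (y : Y) : \bar R := if `[< C y >] then 0%E else +oo%E.

(* The library's default addition has -oo + +oo = -oo; the dual addition has
   -oo + +oo = +oo, as required here. *)
Definition add_indicator g C (y : Y) : \bar R := dual_adde (g y) (indicator C y).

Definition fun_inf g : \bar R := ereal_inf (range g).

Definition fun_dom g : set Y := [set y | (g y < +oo)%E].

Definition approx_argmin delta g : set Y :=
  [set y | fun_dom g y /\ (g y <= fun_inf g + delta%:E)%E].

End extended_real_valued_functions.

Definition epi_converges {R : realType} {Y : metricType R}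
    (g_ : nat -> Y -> \bar R) (g : Y -> \bar R) : Prop :=
  forall y : Y,
    (forall y_ : nat -> Y, y_ @ \oo --> y ->
       (g y <= limn_einf (fun k => g_ k (y_ k)))%E) /\
    (exists2 y_ : nat -> Y, y_ @ \oo --> y &
       (limn_esup (fun k => g_ k (y_ k)) <= g y)%E).

(* Main.v *)
Require Import Defs.
From mathcomp Require Import all_boot all_order all_algebra.
From mathcomp Require Import all_classical all_reals all_analysis.
From mathcomp Require Import lra.
Import Order.TTheory GRing.Theory Num.Theory.
Import numFieldNormedType.Exports.

Local Open Scope classical_set_scope.
Local Open Scope ring_scope.

(** The argument has two independent halves: how far the
    infimum over [Xn n] exceeds [inf f], and how far a cluster point of
    near-minimizers is from minimizing over [Xn n].

    First, the infimum of an epi-limit is at least the limsup of the infima of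
    the approximating functions: if [g y < c], a recovery sequence for [y] has
    values eventually below [c], so the approximating functions eventually take
    values below [c]. Applied to [f] plus the
    indicators of the sets [Xn n], with [c = inf f + eps], this gives points of
    [Xn n], that is of the range of [T n], at which [f] is below
    [inf f + eps] for all large [n] ([epi_converges_indicator_lt]). Only this
    half constrains how large [n] must be beyond [nbar], so the threshold does
    not depend on [delta] or on the near-minimizers.

    Second, for fixed [n], a cluster point [x] of near-minimizers of functions
    that epi-converge to [g] satisfies [g x <= inf g + delta]
    ([cluster_approx_argmin]): along indices where the near-minimizers approach
    [x], their values are asymptotically at least [g x] by the liminf
    condition, and at most [delta] above the values of a recovery sequence of
    any competitor [z], which are asymptotically at most [g z]. The liminf
    condition speaks of full sequences only, so the near-minimizers away from
    [x] are first replaced by [x] itself ([cluster_cvg_frequently_eq]).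

    The two halves give
    [f (T n x) <= inf (f \o T n) + delta <= inf f + eps + delta]. *)

Lemma ereal_between {R : realFieldType} (x y : \bar R) :
  (x < y)%E -> exists r : R, (x < r%:E)%E /\ (r%:E < y)%E.
Proof.
case: x y => [a||] [b||]//.
- rewrite lte_fin => ab; exists ((a + b) / 2); rewrite !lte_fin; split; lra.
- by move=> _; exists (a + 1); rewrite ltry lte_fin ltrDl.
- by move=> _; exists (b - 1); rewrite ltNyr lte_fin ltrBlDl ltrDr.
- by move=> _; exists 0; rewrite ltry ltNyr.
Qed.

Lemma limn_esup_lt_near {R : realType} (u : nat -> \bar R) (a : \bar R) :
  (limn_esup u < a)%E -> \forall k \near \oo, (u k < a)%E.
Proof.
move=> /ereal_inf_lt[_ [V Voo <-] supVa]; apply: filterS Voo => k Vk.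
by apply: le_lt_trans supVa; apply: ereal_sup_ubound; exists k.
Qed.

Lemma limn_einf_gt_near {R : realType} (u : nat -> \bar R) (a : \bar R) :
  (a < limn_einf u)%E -> \forall k \near \oo, (a < u k)%E.
Proof.
rewrite /limn_einf lteNr => /limn_esup_lt_near.
by apply: filterS => k; rewrite lteN2.
Qed.

(** A substitute for subsequences: choosing [s k >= k] with [u (s k)] within
    [1 / (k + 1)] of [x], the sequence equal to [u] on the range of [s] and to
    [x] elsewhere converges to [x] and keeps the original indexing. *)
Lemma cluster_cvg_frequently_eq {R : realType} {M : pseudoMetricType R}
    (u : nat -> M) (x : M) : cluster (u @ \oo) x ->
  exists2 w : nat -> M, w @ \oo --> x &
    forall N : nat, exists2 k, (N <= k)%N & w k = u k.
Proof.
move=> ux.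
have /choice[s sP] : forall k : nat, exists m : nat,
    (k <= m)%N /\ ball x k.+1%:R^-1 (u m).
  move=> k.
  have tail : (u @ \oo) (u @` [set m | (k <= m)%N]).
    by exists k => // m /= km; exists m.
  have near_x : nbhs x (ball x k.+1%:R^-1) by apply: nbhsx_ballx; rewrite invr_gt0.
  have [_ [[m /= km <-] xum]] := ux _ _ tail near_x.
  by exists m.
exists (fun m => if `[< exists k, s k = m >] then u m else x); last first.
  move=> N; exists (s N); first by have [] := sP N.
  by case: asboolP => // -[]; exists N.
apply/cvg_ballP => e e0.
have [k0 _ k0e] := near_infty_natSinv_lt (PosNum e0).
(* Beyond s 0, ..., s (k0 - 1), an index s k must have k >= k0. *)
exists (\max_(k < k0) s k).+1 => // m /= ltm.
case: asboolP => [[k skm]|_]; last exact: ballxx.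
have [kk0|k0k] := ltnP k k0.
  have := leq_bigmax_cond (P := xpredT) (F := fun k : 'I_k0 => s k) (Ordinal kk0) isT.
  by rewrite /= skm leqNgt ltm.
rewrite -skm; apply: le_ball (sP k).2.
by apply/ltW; apply: k0e.
Qed.

Lemma epi_converges_lt {R : realType} {Y : metricType R}
    (g_ : nat -> Y -> \bar R) (g : Y -> \bar R) (y : Y) (c : \bar R) :
  epi_converges g_ g -> (g y < c)%E ->
  exists y_ : nat -> Y, \forall k \near \oo, (g_ k (y_ k) < c)%E.
Proof.
move=> /(_ y)[_ [y_ _ limsup_le]] gyc; exists y_.
by apply: limn_esup_lt_near; apply: le_lt_trans gyc.
Qed.

(** Values of [g + indicator C] below [+oo] are taken inside [C]; the recovery
    sequence of a point where [g < c] is therefore eventually in the sets. *)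
Lemma epi_converges_indicator_lt {R : realType} {Y : metricType R}
    (g : Y -> \bar R) (C : nat -> set Y) (c : \bar R) :
  epi_converges (fun n => add_indicator g (C n)) g -> (fun_inf g < c)%E ->
  \forall n \near \oo, exists2 y, C n y & (g y < c)%E.
Proof.
move=> epi_g /ereal_inf_lt[_ [y _ <-] gyc].
have [y_] := epi_converges_lt _ _ _ _ epi_g gyc.
apply: filterS => n; rewrite /add_indicator /indicator.
case: asboolP => [Cy|_]; last by case: (g (y_ n)); rewrite /dual_adde/= ltNge leey.
move=> lt_c; exists (y_ n) => //; move: lt_c.
by case: (g (y_ n)) => [r||]; rewrite /dual_adde//= addr0.
Qed.

(** Otherwise some real [c] satisfies [inf g < c] and [c + delta < g x]. A
    competitor [z] with [g z < c] has a recovery sequence with values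
    eventually below some [c' < c]; the gap [c - c'] absorbs the difference
    between [delta_ k] and its limit. *)
Lemma cluster_approx_argmin {R : realType} {Y : metricType R}
    (g_ : nat -> Y -> \bar R) (g : Y -> \bar R) (delta_ : nat -> R) (delta : R)
    (x_ : nat -> Y) (x : Y) :
  epi_converges g_ g -> delta_ @ \oo --> delta ->
  (forall k, approx_argmin (delta_ k) (g_ k) (x_ k)) ->
  cluster (x_ @ \oo) x -> (g x <= fun_inf g + delta%:E)%E.
Proof.
move=> epi_g delta_cvg x_min x_x; rewrite leNgt; apply/negP.
move=> /ereal_between[r [inf_r r_gx]].
have [|_ [z _ <-] gzc] := @ereal_inf_lt _ (range g) (r - delta)%:E.
  by rewrite EFinB lteBrDr.
have [c' [gzc' c'c]] := ereal_between _ _ gzc.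
have [z_ z_c'] := epi_converges_lt _ _ _ _ epi_g gzc'.
have [w wx w_freq] := cluster_cvg_frequently_eq _ _ x_x.
have w_gt : \forall k \near \oo, (r%:E < g_ k (w k))%E.
  by apply: limn_einf_gt_near; apply: lt_le_trans r_gx _; exact: (epi_g x).1.
have delta_lt : \forall k \near \oo, delta_ k < r - c'.
  by apply: (cvgr_lt delta) => //; move: c'c; rewrite lte_fin; lra.
have [N _ PN] := filterI z_c' (filterI w_gt delta_lt).
have [k Nk wk] := w_freq N.
have [/= zk [rk dk]] := PN k Nk.
have [_ xk] := x_min k.
have inf_le : (fun_inf (g_ k) <= g_ k (z_ k))%E.
  by apply: ereal_inf_lbound; exists (z_ k).
have : (r%:E < c'%:E + (r - c')%:E)%E.
  rewrite wk in rk; apply: lt_le_trans rk _; apply: (le_trans xk).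
  apply: leeD; last by rewrite lee_fin ltW.
  by apply: (le_trans inf_le); exact: ltW.
by rewrite -EFinD lte_fin addrC subrK ltxx.
Qed.

Theorem theorem3p2 (R : realType) (X : metricType R) (f : X -> \bar R)
    (Xn : nat -> set X)
    (T : forall n : nat, euclidean R n -> X)
    (T_surj : forall n : nat, (0 < n)%N -> range (T n) = Xn n)
    (fn : forall n : nat, euclidean R n -> \bar R)
    (fnE : forall (n : nat) (x : euclidean R n), fn n x = f (T n x))
    (fnu : forall n : nat, nat -> euclidean R n -> \bar R)
    (nbar : nat)
    (epi_f : epi_converges (fun n => add_indicator f (Xn n)) f)
    (epi_fn : forall n : nat, (nbar <= n)%N -> epi_converges (fnu n) (fn n))
    (inf_f : (-oo < fun_inf f)%E)
    (inf_fn : forall n : nat, (nbar <= n)%N -> (fun_inf (fn n) < +oo)%E)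
    (eps : R) (eps_gt0 : 0 < eps) :
  exists2 neps : nat, (nbar <= neps)%N &
    forall n : nat, (neps <= n)%N ->
    forall (deltanu : nat -> R) (delta : R),
      (forall nu : nat, 0 <= deltanu nu) -> 0 <= delta ->
      deltanu @ \oo --> delta ->
    forall (xnu : nat -> euclidean R n) (x : euclidean R n),
      (forall nu : nat, approx_argmin (deltanu nu) (fnu n nu) (xnu nu)) ->
      cluster (xnu @ \oo) x ->
      (f (T n x) <= fun_inf f + eps%:E + delta%:E)%E.
Proof.
have [inf_y|inf_ny] := eqVneq (fun_inf f) +oo%E.
  by exists nbar => // n _ *; rewrite inf_y leey.
have inf_fin : fun_inf f \is a fin_num by rewrite fin_numE inf_ny gt_eqF.
have inf_lt : (fun_inf f < fun_inf f + eps%:E)%E by rewrite lteDl// lte_fin.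
have [N _ XnN] := epi_converges_indicator_lt _ _ _ epi_f inf_lt.
(* The range of T n is Xn n for n > 0 only, hence the successor. *)
exists (maxn nbar N.+1); first exact: leq_maxl.
move=> n; rewrite geq_max => /andP[nbar_n N_n] deltanu delta _ _ delta_cvg.
move=> xnu x xnu_min xnu_x.
have [y Xny fy] := XnN n (ltnW N_n).
have [z _ Tz] : range (T n) y by rewrite T_surj// (leq_trans _ N_n).
rewrite -fnE; apply: le_trans.
  exact: cluster_approx_argmin (epi_fn n nbar_n) delta_cvg xnu_min xnu_x.
apply: leeD => //; apply: le_trans (ltW fy).
by apply: ereal_inf_lbound; exists z => //; rewrite fnE Tz.
Qed.
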